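(* For every integer $r\ge 0$: if there is a double cover of $\{0,1,2\}^r$ with $N$ boxes, then there is a double cover of $\{0,1,2\}^{r+3}$ with $6\cdot 2^r+3N$ boxes. Hence $$f(r+3)\le 6\cdot 2^r+3f(r)\qquad\text{for all } r\ge 0.$$
   Context: Write $[3]=\{0,1,2\}$. A proper sub-box of $[3]^d$ is a set $B=S_1\times\dots\times S_d$ with $\varnothing\neq S_i\subsetneq[3]$ for every $1\le i\le d$ (so each side $S_i$ has one or two elements). A double cover of $[3]^d$ is a finite multiset $\{B_1,\dots,B_m\}$ of proper sub-boxes such that every point of $[3]^d$ lies in exactly two of the $B_j$, counted with multiplicity; its size (number of boxes) is $m$. $f(d)$ denotes the minimum size of a double cover of $[3]^d$. For $d=0$, $[3]^0$ is a single point, which is itself the only proper sub-box (empty product). *)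

(* Defs.v *)
From mathcomp Require Import all_boot.
From mathcomp Require Import finmap multiset boolp.

Set Implicit Arguments.
Unset Strict Implicit.
Unset Printing Implicit Defensive.

Local Open Scope mset_scope.

Definition grid (d : nat) : finType := {ffun 'I_d -> 'I_3}.

Definition box (d : nat) (S : 'I_d -> {set 'I_3}) : {set grid d} :=
  [set x : grid d | [forall i, x i \in S i]].

Definition proper_sub_box (d : nat) (B : {set grid d}) : Prop :=
  exists S : 'I_d -> {set 'I_3},
    (forall i, S i != set0 /\ S i \proper [set: 'I_3]) /\ B = box S.

(* The coercion of a multiset to a sequence repeats each element according to
   its multiplicity, so [count] below and [size] in [has_double_cover] count
   boxes with multiplicity. *)
Definition double_cover (d : nat) (M : {mset {set grid d}}) : Prop :=
  (forall B, B \in M -> proper_sub_box B) /\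
  (forall x : grid d, count (fun B : {set grid d} => x \in B) M = 2).

Definition has_double_cover (d m : nat) : Prop :=
  exists M : {mset {set grid d}}, double_cover M /\ size M = m.

(* Splitting every side into {0} and {1,2} partitions the grid into 2 ^ d proper
   sub-boxes; taking each of them twice gives a double cover. *)
Lemma has_double_cover_ex (d : nat) : exists m, `[< has_double_cover d m >].
Proof.
pose side (A : {set 'I_d}) i : {set 'I_3} :=
  if i \in A then [set ord0] else ~: [set ord0].
pose s := [seq box (side A) | A : {set 'I_d}].
exists (size (seq_mset (s ++ s))); apply/asboolP.
exists (seq_mset (s ++ s)); split=> //; split=> [B|x].
  rewrite (perm_mem (perm_eq_seq_mset _)) mem_cat orbb.
  case/mapP=> A _ ->; exists (side A); split=> // i; rewrite /side.
  have o1 : (Ordinal (isT : 1 < 3)) != ord0 :> 'I_3 by [].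
  case: ifP => _; split.
  - by apply/set0Pn; exists ord0; rewrite inE.
  - by rewrite properT; apply/eqP => /setP/(_ (Ordinal (isT : 1 < 3))); rewrite !inE.
  - by apply/set0Pn; exists (Ordinal (isT : 1 < 3)); rewrite !inE.
  - by rewrite properT; apply/eqP => /setP/(_ ord0); rewrite !inE.
rewrite (permP (perm_eq_seq_mset _)) count_cat.
suff -> : count (fun B : {set grid d} => x \in B) s = 1 by [].
rewrite /s /image_mem count_map.
rewrite (@eq_count _ _ (pred1 [set i | x i == ord0])); last first.
  move=> A; rewrite /= inE; apply/forallP/eqP => [xA|-> i].
    apply/setP=> i; move: (xA i); rewrite /side inE.
    by case: ifP => _; rewrite !inE; [move/eqP->; rewrite eqxx | move/negPf].
  by rewrite /side inE; case: ifP => xi; rewrite !inE xi.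
by rewrite count_uniq_mem ?enum_uniq // mem_enum.
Qed.

Definition f (d : nat) : nat := ex_minn (has_double_cover_ex d).

(* Main.v *)
Require Import Defs.
From mathcomp Require Import all_boot.
From mathcomp Require Import multiset boolp.

Set Implicit Arguments.
Unset Strict Implicit.
Unset Printing Implicit Defensive.

(** In [3]^3 the six 2x2x2 boxes that avoid the value p(i) in coordinate i, for p
    a permutation of [3], cover every nonconstant point exactly twice and miss
    the three constant points. Multiply each of these boxes by a partition of
    [3]^r into 2^r boxes, and each constant point by the given double cover. *)

(** The multiplicity [k] is a parameter because both partitions ([k = 1]) and double covers
    ([k = 2]) of $[3]^r$ serve as factors. *)
Definition proper_cover (k d : nat) (s : seq {set grid d}) : Prop :=
  (forall B, B \in s -> proper_sub_box B) /\
  (forall x : grid d, count (fun B : {set grid d} => x \in B) s = k).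

(** Allows working with sequences, where unions and products of families are concatenations and
    comprehensions. *)
Lemma has_double_coverP (d m : nat) :
  has_double_cover d m <-> exists2 s, @proper_cover 2 d s & size s = m.
Proof.
split=> [[M [[MP Mc] Mm]]|[s [sP sc] sm]]; first by exists (M : seq _).
have sM := perm_eq_seq_mset s.
exists (seq_mset s); split; last by rewrite (perm_size sM).
split=> [B|x]; last by rewrite (permP sM).
by rewrite (perm_mem sM); apply: sP.
Qed.

Lemma proper_subset_ord3 (A : {set 'I_3}) (i j : 'I_3) :
  i \in A -> j \notin A -> A != set0 /\ A \proper [set: 'I_3].
Proof.
move=> iA jA; split; first by apply/set0Pn; exists i.
by rewrite properT; apply: contraNneq jA => ->; rewrite inE.
Qed.

(** Each side is cut into {0} and {1,2}, and [A] records the coordinates whose side is {0}. A point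
    lies only in the box whose [A] is its set of zero coordinates. *)
Lemma proper_cover1_ex (d : nat) :
  exists2 s, @proper_cover 1 d s & size s = 2 ^ d.
Proof.
pose side (A : {set 'I_d}) i : {set 'I_3} :=
  if i \in A then [set ord0] else ~: [set ord0].
exists [seq box (side A) | A : {set 'I_d}]; last first.
  by rewrite size_map -cardE -cardsT -powersetT card_powerset cardsT card_ord.
split=> [B /mapP[A _ ->]|x].
  exists (side A); split=> // i; rewrite /side; case: ifP => _.
    by apply: (@proper_subset_ord3 _ ord0 ord_max); rewrite !inE.
  by apply: (@proper_subset_ord3 _ ord_max ord0); rewrite !inE.
rewrite count_map (@eq_count _ _ (pred1 [set i | x i == ord0])) => [|A].
  by rewrite count_uniq_mem ?enum_uniq // mem_enum.
rewrite /= inE; apply/forallP/eqP => [xA|-> i].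
  apply/setP=> i; move: (xA i); rewrite /side inE.
  by case: ifP => _; rewrite !inE; [move/eqP->; rewrite eqxx | move/negPf].
by rewrite /side inE; case: ifP => xi; rewrite !inE xi.
Qed.

Section Product.

Variables m n : nat.

Definition lgrid (x : grid (m + n)) : grid m := [ffun i => x (lshift n i)].

Definition rgrid (x : grid (m + n)) : grid n := [ffun i => x (rshift m i)].

Definition grid_setX (B : {set grid m}) (C : {set grid n}) :
    {set grid (m + n)} :=
  [set x | (lgrid x \in B) && (rgrid x \in C)].

Lemma proper_sub_box_setX B C :
  proper_sub_box B -> proper_sub_box C -> proper_sub_box (grid_setX B C).
Proof.
move=> [S [SP ->]] [T [TP ->]].
exists (fun i => match split i with inl j => S j | inr j => T j end).
split=> [i|]; first by case: (split i).
apply/setP=> x; rewrite !inE; apply/andP/forallP.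
  move=> [/forallP xS /forallP xT] i.
  case: (splitP i) => j ij.
    by rewrite (_ : i = lshift n j); [have:= xS j; rewrite ffunE | apply: val_inj].
  by rewrite (_ : i = rshift m j); [have:= xT j; rewrite ffunE | apply: val_inj].
move=> xST; split; apply/forallP=> j; rewrite ffunE.
  by have:= xST (lshift n j); rewrite (unsplitK (inl j)).
by have:= xST (rshift m j); rewrite (unsplitK (inr j)).
Qed.

(** Membership in a product box is a conjunction of two independent conditions, so covering
    multiplicities multiply. *)
Lemma count_grid_setX x (s : seq {set grid m}) (t : seq {set grid n}) :
  count (fun D : {set grid (m + n)} => x \in D)
    [seq grid_setX B C | B <- s, C <- t] =
  count (fun B : {set grid m} => lgrid x \in B) s *
  count (fun C : {set grid n} => rgrid x \in C) t.
Proof.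
elim: s => //= B s IHs; rewrite count_cat IHs mulnDl; congr (_ + _).
rewrite count_map; case: (boolP (lgrid x \in B)) => xB; rewrite ?mul1n ?mul0n.
  by apply: eq_count => C /=; rewrite inE xB.
by rewrite -[RHS](count_pred0 t); apply: eq_count => C /=; rewrite inE (negPf xB).
Qed.

End Product.

(** A permutation is a sequence of naturals, so that counting over all six of them is a closed
    computation. *)
Definition brick (p : seq nat) : {set grid 3} :=
  box (fun i => [set j : 'I_3 | j != nth 0 p i :> nat]).

Definition bricks : seq {set grid 3} :=
  [seq brick p | p <- permutations (iota 0 3)].

Definition diagonal_point (t : nat) : {set grid 3} :=
  box (fun=> [set j : 'I_3 | j == t :> nat]).

Definition diagonal : seq {set grid 3} :=
  [seq diagonal_point t | t <- iota 0 3].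

Lemma forall_ord3 (P : pred 'I_3) :
  [forall i, P i] = [&& P (inord 0), P (inord 1) & P (inord 2)].
Proof.
apply/forallP/and3P => [P_ //|[P0 P1 P2] i]; rewrite -(inord_val i).
by case: i => [[|[|[|]]]].
Qed.

Lemma proper_brick B : B \in bricks -> proper_sub_box B.
Proof.
case/mapP=> p; rewrite mem_permutations => p3 ->.
exists (fun i => [set j : 'I_3 | j != nth 0 p i :> nat]); split=> // i.
have: nth 0 p i < 3.
  have: nth 0 p i \in p by rewrite mem_nth // (perm_size p3).
  by rewrite (perm_mem p3) mem_iota.
(* The side omits exactly the value p(i); it contains 2 if that value is 0, and 0 otherwise. *)
case: (nth 0 p i) => [|k] k3.
  by apply: (@proper_subset_ord3 _ ord_max ord0); rewrite !inE.
by apply: (@proper_subset_ord3 _ ord0 (Ordinal k3)); rewrite !inE ?eqxx.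
Qed.

Lemma proper_diagonal B : B \in diagonal -> proper_sub_box B.
Proof.
case/mapP=> t; rewrite mem_iota => /= t3 ->.
exists (fun=> [set j : 'I_3 | j == t :> nat]); split=> // _.
case: t t3 => [|t] t3.
  by apply: (@proper_subset_ord3 _ ord0 ord_max); rewrite !inE.
by apply: (@proper_subset_ord3 _ (Ordinal t3) ord0); rewrite !inE ?eqxx.
Qed.

(** A nonconstant point lies in two bricks and no diagonal box, a constant one in no brick and one
    diagonal box. The weight 2 is the multiplicity contributed by the double cover of $[3]^r$. *)
Lemma count_bricks_diagonal (y : grid 3) :
  count (fun B : {set grid 3} => y \in B) bricks +
  2 * count (fun B : {set grid 3} => y \in B) diagonal = 2.
Proof.
rewrite !count_map.
rewrite (@eq_count _ _ (fun p : seq nat => [&& y (inord 0) != nth 0 p 0 :> nat,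
  y (inord 1) != nth 0 p 1 :> nat & y (inord 2) != nth 0 p 2 :> nat])); last first.
  by move=> p; rewrite /= inE forall_ord3 !inE !inordK.
rewrite (@eq_count _ _ (fun t : nat => [&& y (inord 0) == t :> nat,
  y (inord 1) == t :> nat & y (inord 2) == t :> nat])); last first.
  by move=> t; rewrite /= inE forall_ord3 !inE.
(* With the coordinates abstracted to naturals below 3, only 27 closed numerical cases remain. *)
move: (nat_of_ord (y (inord 0))) (ltn_ord (y (inord 0))).
move: (nat_of_ord (y (inord 1))) (ltn_ord (y (inord 1))).
move: (nat_of_ord (y (inord 2))) (ltn_ord (y (inord 2))).
by do 3![case=> [|[|[|//]]] _]; vm_compute.
Qed.

Lemma has_double_cover_add3 (r N : nat) :
  has_double_cover r N -> has_double_cover (r + 3) (6 * 2 ^ r + 3 * N).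
Proof.
move=> /has_double_coverP[s2 [s2P s2c] s2N].
have [s1 [s1P s1c] s1N] := proper_cover1_ex r.
apply/has_double_coverP.
exists ([seq grid_setX B C | B <- s1, C <- bricks] ++
        [seq grid_setX B C | B <- s2, C <- diagonal]); last first.
  by rewrite size_cat !size_allpairs s1N s2N !(mulnC _ (size _)) !size_map.
split=> [D|x]; last first.
  (* The partition [s1] contributes the factor 1 to the bricks, and [s2] the factor 2 to the
     diagonal. *)
  rewrite count_cat !count_grid_setX s1c s2c mul1n.
  exact: count_bricks_diagonal.
rewrite mem_cat => /orP[] /allpairsP[[B C] /= [Bs Ct ->]].
  by apply: proper_sub_box_setX; [apply: s1P | apply: proper_brick].
by apply: proper_sub_box_setX; [apply: s2P | apply: proper_diagonal].
Qed.

Theorem theorem7p1 :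
  (forall r N : nat,
     has_double_cover r N -> has_double_cover (r + 3) (6 * 2 ^ r + 3 * N)) /\
  (forall r : nat, f (r + 3) <= 6 * 2 ^ r + 3 * f r).
Proof.
split=> [|r]; first exact: has_double_cover_add3.
have fr : has_double_cover r (f r).
  by rewrite /f; case: ex_minnP => m /asboolP.
(* By minimality of [f (r + 3)], it suffices to exhibit a cover of the stated size. *)
rewrite {1}/f; case: ex_minnP => m _; apply.
by apply/asboolP; apply: has_double_cover_add3.
Qed.
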